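(* Let $G$ be a graph and write $k = \lfloor m(G) \rfloor$ and $K = \lfloor 2m(G) \rfloor$. Then there are forests $F_K, F_{K-1}, \dots, F_{k+1}$, each a subgraph of $G$, such that: (a) for each integer $i$ with $k+1 \le i \le K$, the graph $F_i$ has maximum degree at most $\left\lceil \frac{i}{i - m(G)} \right\rceil$; (b) for each integer $j$ with $k \le j \le K$, the graph $B_j := \bigcup_{j < i \le K} F_i$ is $(K-j)$-degenerate, and the graph $G \setminus B_j$ is $j$-degenerate.
   Context: All graphs are finite and simple; $v_G$ and $e_G$ denote the numbers of vertices and edges of a graph $G$. The maximal density of $G$ is \[ m(G) = \max \left\{ \frac{e_{G'}}{v_{G'}} : \emptyset \neq G' \subseteq G \right\},\] the maximum being over all subgraphs with at least one vertex. A graph is $d$-degenerate if every nonempty subgraph of it has a vertex of degree at most $d$ in that subgraph; equivalently, its vertices can be linearly ordered so that, orienting each edge according to the ordering, every vertex has out-degree at most $d$. $G \setminus B$ denotes the graph obtained from $G$ by deleting the edges of $B$. An empty union (the case $j = K$) is the graph with no edges. *)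

(* Defs.v *)
From HB Require Import structures.
From mathcomp Require Import all_boot all_order all_algebra.

Set Implicit Arguments.
Unset Strict Implicit.
Unset Printing Implicit Defensive.

Import Order.TTheory GRing.Theory Num.Theory.

(* A finite simple graph is a pair (V, E): V is a set of vertices taken in an
   ambient finite type T, and E is a set of 2-element subsets of V.  A graph on
   T need not use all of T as vertices, so the subgraphs of a graph on T,
   whatever their vertex sets, are again terms of type sgraph T. *)
Definition wf_graph (T : finType) (p : {set T} * {set {set T}}) : bool :=
  [forall e in p.2, (#|e| == 2) && (e \subset p.1)].

Record sgraph (T : finType) := SGraph {
  gdata : {set T} * {set {set T}};
  gdataP : wf_graph gdata
}.

HB.instance Definition _ (T : finType) := [isSub for @gdata T].
HB.instance Definition _ (T : finType) := [Finite of sgraph T by <:].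

Section GraphDefs.
Variable T : finType.
Implicit Types (G H B : sgraph T) (x y : T) (d : nat).

Definition vset G : {set T} := (gdata G).1.
Definition eset G : {set {set T}} := (gdata G).2.

Definition subgraph H G : bool :=
  (vset H \subset vset G) && (eset H \subset eset G).

Definition density H : rat := ((#|eset H|)%:R / (#|vset H|)%:R)%R.

(* Densities are nonnegative, so the base value 0 only matters for the graph
   without vertices, for which the maximum is empty. *)
Definition max_density G : rat :=
  \big[Num.max/0%R]_(H : sgraph T | subgraph H G && (vset H != set0)) density H.

Definition adj G : rel T := fun x y => [set x; y] \in eset G.

Definition deg G x : nat := #|[set e in eset G | x \in e]|.

Definition max_deg G : nat := \max_(x in vset G) deg G x.

Definition is_forest G : Prop :=
  forall c : seq T, 2 < size c -> ~ ucycle (adj G) c.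

Definition degenerate d G : Prop :=
  forall H, subgraph H G -> vset H != set0 ->
    exists2 x, x \in vset H & deg H x <= d.

Lemma null_graph_wf : wf_graph (set0 : {set T}, set0 : {set {set T}}).
Proof. by apply/forall_inP => e; rewrite inE. Qed.

Definition null_graph : sgraph T := SGraph null_graph_wf.

Lemma graph_union_wf G H : wf_graph (vset G :|: vset H, eset G :|: eset H).
Proof.
apply/forall_inP => e /setUP[eG|eH].
  have /andP[-> sVe] := forall_inP (gdataP G) e eG.
  by rewrite (subset_trans sVe) // subsetUl.
have /andP[-> sVe] := forall_inP (gdataP H) e eH.
by rewrite (subset_trans sVe) // subsetUr.
Qed.

Definition graph_union G H : sgraph T := SGraph (graph_union_wf G H).

Lemma delete_edges_wf G B : wf_graph (vset G, eset G :\: eset B).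
Proof.
by apply/forall_inP => e /setDP[eG _]; exact: (forall_inP (gdataP G) e eG).
Qed.

Definition delete_edges G B : sgraph T := SGraph (delete_edges_wf G B).

End GraphDefs.

Arguments null_graph {T}.

(* Main.v *)
Require Import Defs.
From mathcomp Require Import all_boot all_order all_algebra.
From mathcomp Require Import lra zify.

Set Implicit Arguments.
Unset Strict Implicit.
Unset Printing Implicit Defensive.

Import Order.TTheory GRing.Theory Num.Theory.

(* Since every subgraph has average degree at most 2m, G is K-degenerate; fix a
   linear order in which every vertex has at most K later neighbours.  Going
   down from i = K to k + 1, each vertex with exactly i remaining later
   neighbours gives up one of them to F_i.  If S is a set of such vertices with
   later neighbourhood N(S), the i|S| edges leaving S live on at most
   |S| + |N(S)| vertices, so i|S| <= m (|S| + |N(S)|).  Hall's theorem with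
   capacities then lets every vertex be chosen at most ceil(m / (i - m)) times.
   All conclusions are read off the same order: F_i has at most one later
   neighbour per vertex, so it is a forest, and each B_j has at most K - j. *)

(** * Hall's theorem with capacities *)

(* Rado's argument: as long as some [N x] has two elements, one of the two can
   be dropped, since two violators would contradict submodularity of the
   neighbourhood size. *)
Lemma hall_capacity (A B : finType) (f0 : A -> B) (c : nat) (D : {set A})
    (N : A -> {set B}) :
    (forall S : {set A}, S \subset D -> #|S| <= c * #|\bigcup_(x in S) N x|) ->
  exists f : A -> B, {in D, forall x, f x \in N x} /\
    forall y, #|[set x in D | f x == y]| <= c.
Proof.
have [n] := ubnP (\sum_(x in D) #|N x|); elim: n => // n IHn in N * => leNn hallN.
have [|/exists_inPn N1] := boolP [exists x in D, 1 < #|N x|]; last first.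
  (* When every [N x] has at most one element, [f] is forced. The default [f0 x] is taken only where
     [N x] is empty, which Hall's condition for [[set x]] excludes on [D]. The fibre over [y] has
     its neighbours inside [[set y]], so Hall's condition bounds it by [c]. *)
  pose f x := odflt (f0 x) [pick y in N x].
  have fN : {in D, forall x, f x \in N x}.
    move=> x xD; rewrite /f; case: pickP => //= N0.
    have := hallN [set x]; rewrite sub1set cards1 big_set1 => /(_ xD).
    by rewrite (eq_card0 N0) muln0.
  have Nf x : x \in D -> N x \subset [set f x].
    move=> xD; apply/subsetP => y yN; rewrite inE.
    have /negbTE := N1 x xD; apply: contraFT => neq.
    by apply/card_gt1P; exists y, (f x); rewrite fN.
  exists f; split=> // y; set S := [set x in D | _].
  have SD : S \subset D by apply/subsetP => x; rewrite inE => /andP[].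
  apply: leq_trans (hallN S SD) _; rewrite -[X in _ <= X]muln1 leq_mul2l.
  rewrite -(cards1 y) subset_leq_card ?orbT //.
  apply/bigcupsP => x; rewrite inE => /andP[xD /eqP <-]; exact: Nf.
case/exists_inP => x xD /card_gt1P[y1 [y2 [Ny1 Ny2 neq12]]].
pose N' y z := if z == x then N x :\ y else N z.
have N'N y z : N' y z \subset N z.
  by rewrite /N'; case: eqP => // ->; rewrite subsetDl.
have drop y : y \in N x ->
    (forall S : {set A}, S \subset D ->
       #|S| <= c * #|\bigcup_(z in S) N' y z|) ->
    exists f : A -> B, {in D, forall x, f x \in N x} /\
      forall y, #|[set x in D | f x == y]| <= c.
  move=> yN hallN'; case: (IHn (N' y)) => // [|f [fN' fc]].
    rewrite (bigD1 x) //= in leNn; rewrite (bigD1 x) //=.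
    rewrite {1}/N' eqxx -ltnS (leq_trans _ leNn) // ltnS.
    rewrite (cardsD1 y (N x)) yN add1n addSn ltnS leq_add2l.
    by apply: leq_sum => z _; rewrite subset_leq_card.
  exists f; split=> // z zD; exact: subsetP (N'N y z) _ (fN' z zD).
pose bad y (S : {set A}) :=
  (S \subset D) && (c * #|\bigcup_(z in S) N' y z| < #|S|).
have [/existsP[S1 /andP[S1D bad1]]|/existsPn ok1] := boolP [exists S, bad y1 S];
  last first.
  apply: (drop y1) => // S SD; have := ok1 S.
  by rewrite /bad SD /= -leqNgt.
have [/existsP[S2 /andP[S2D bad2]]|/existsPn ok2] := boolP [exists S, bad y2 S];
  last first.
  apply: (drop y2) => // S SD; have := ok2 S.
  by rewrite /bad SD /= -leqNgt.
(* [N'] differs from [N] only at [x], so every violator contains [x]. *)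
have xbad y (S : {set A}) : S \subset D -> c * #|\bigcup_(z in S) N' y z| < #|S| -> x \in S.
  move=> SD; apply: contraTT => xS; rewrite -leqNgt (leq_trans (hallN S SD)) //.
  rewrite leq_mul2l subset_leq_card ?orbT //.
  apply/bigcupsP => z zS; apply: (bigcup_max z) => //.
  by rewrite /N'; case: eqP zS xS => // -> ->.
have [x1 x2] := (xbad _ _ S1D bad1, xbad _ _ S2D bad2).
have hallU := hallN (S1 :|: S2); rewrite subUset S1D S2D in hallU.
(* The vertex [x] is removed from the intersection so that [N'] and [N] agree on it; this costs only
   1 in the count below. *)
have hallI := hallN ((S1 :&: S2) :\ x).
rewrite (subset_trans (subsetDl _ _)) ?subIset ?S1D // in hallI.
set U1 := \bigcup_(z in S1) _ in bad1; set U2 := \bigcup_(z in S2) _ in bad2.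
(* Nothing of [N x] is lost in the union: [y1] survives in [U2] and every other element in [U1]. *)
have leU : #|\bigcup_(z in S1 :|: S2) N z| <= #|U1 :|: U2|.
  apply/subset_leq_card/bigcupsP => z zS; apply/subsetP => y yN.
  have [ezx|nzx] := eqVneq z x.
    have [ey|ny] := eqVneq y y1.
      rewrite inE; apply/orP; right; apply/bigcupP; exists x => //.
      by rewrite /N' eqxx !inE -ezx yN ey neq12.
    rewrite inE; apply/orP; left; apply/bigcupP; exists x => //.
    by rewrite /N' eqxx !inE -ezx yN ny.
  case/setUP: zS => zS; rewrite inE; apply/orP; [left|right];
    by apply/bigcupP; exists z => //; rewrite /N' (negbTE nzx).
have leI : #|\bigcup_(z in (S1 :&: S2) :\ x) N z| <= #|U1 :&: U2|.
  apply/subset_leq_card/bigcupsP => z; rewrite !inE => /and3P[nzx z1 z2].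
  rewrite subsetI /U1 /U2; apply/andP; split; apply: (bigcup_max z) => //;
    by rewrite /N' (negbTE nzx).
(* The two Hall bounds give [#|S1| + #|S2| - 1 <= c * (#|U1| + #|U2|)], whereas two violators force
   at most [#|S1| + #|S2| - 2] on the right. *)
have := cardsUI S1 S2; have := cardsUI U1 U2.
rewrite (cardsD1 x (S1 :&: S2)) inE x1 x2 /=.
have := hallU isT; have := hallI isT; nia.
Qed.

(** * Vertex orders and later neighbours *)

Section Graph.
Variable T : finType.
Implicit Types (G H : sgraph T) (E : {set {set T}}) (x y : T) (r : T -> nat).

(* The comparison is not strict, so that the next lemmas bounding degrees by
   [later] hold for any [r], injective or not. *)
Definition later r E x : {set T} := [set y | ([set x; y] \in E) && (r x <= r y)].

Lemma edge_vset G x y : adj G x y -> (x \in vset G) && (y \in vset G).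
Proof.
move=> xyG; have /andP[_ /subsetP sub] := forall_inP (gdataP G) _ xyG.
by rewrite !sub ?set21 ?set22.
Qed.

Lemma edge_neq G x y : adj G x y -> x != y.
Proof.
by move=> xyG; have /andP[] := forall_inP (gdataP G) _ xyG; rewrite cards2; case: (x != y).
Qed.

Lemma degE G x : deg G x = #|[set y | adj G x y]|.
Proof.
have inj : injective (fun y => [set x; y]).
  move=> y z /setP eq; have := eq y; have := eq z; rewrite !inE !eqxx !orbT.
  by case/orP=> /eqP-> // /esym; rewrite orbb => /eqP.
rewrite -(card_imset _ inj); apply: eq_card => e; rewrite !inE.
apply/andP/imsetP => [[eG xe]|[y]]; last by rewrite inE => xyG ->; rewrite set21.
have /andP[/cards2P[a [b [_ def_e]]] _] := forall_inP (gdataP G) _ eG.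
move: xe eG; rewrite def_e => /set2P[]<- eG; last first.
  by exists a; [rewrite inE /adj setUC | rewrite setUC].
by exists b => //; rewrite inE.
Qed.

Lemma later_sub r E E' x : E \subset E' -> later r E x \subset later r E' x.
Proof.
move=> EE'; apply/subsetP => y; rewrite !inE => /andP[/(subsetP EE')->]; exact.
Qed.

(** In a nonempty subgraph, all neighbours of a vertex with least [r] are later. *)
Lemma later_degenerate r d G :
  (forall x, #|later r (eset G) x| <= d) -> degenerate d G.
Proof.
move=> led H /andP[_ HG] /set0Pn[x0 x0H].
case: (arg_minnP r x0H) => x xH minx; exists x => //.
apply: leq_trans (led x); rewrite degE; apply/subset_leq_card/subsetP => y.
rewrite !inE => xyH; rewrite (subsetP HG) //=; apply: minx.
by have /andP[] := edge_vset xyH.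
Qed.

(** On a cycle, a vertex with least [r] has two distinct later neighbours: its successor and its
    predecessor. *)
Lemma later_forest r G : (forall x, #|later r (eset G) x| <= 1) -> is_forest G.
Proof.
move=> le1 c c2 /andP[cyc uniq_c].
have [x0 x0c] : exists x, x \in c by case: (c) c2 => // x s _; exists x; apply: mem_head.
have [x xc minx] := arg_minnP r x0c.
have [i s def_s] := rot_to xc.
rewrite -(rot_cycle i) def_s in cyc; rewrite -(rot_uniq i c) def_s in uniq_c.
rewrite -(size_rot i c) def_s in c2.
have sc y : y \in s -> y \in c by rewrite -(mem_rot i c) def_s inE orbC => ->.
case: s {def_s} => [|y [|z s]] // in cyc uniq_c c2 sc.
rewrite /= rcons_path -/(last y (z :: s)) in cyc; case/and4P: cyc => xy _ _ zx.
have y_later : y \in later r (eset G) x.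
  by rewrite inE [_ \in _]xy; apply/minx/sc/mem_head.
have z_later : last z s \in later r (eset G) x.
  by rewrite inE setUC [_ \in _]zx; apply/minx/sc; rewrite inE mem_last orbT.
have /card_le1_eqP/(_ _ _ y_later z_later) eq := le1 x.
by case/and3P: uniq_c => _ /negP[]; rewrite -eq mem_last.
Qed.

(** Repeatedly remove a vertex of degree at most [d] in what remains, and order the vertices by time
    of removal. *)
Lemma later_order d G : degenerate d G ->
  exists2 r, {in vset G &, injective r} & forall x, #|later r (eset G) x| <= d.
Proof.
move=> degG.
suff /(_ (vset G) (subxx _)) [r r_inj rP] : forall U : {set T}, U \subset vset G ->
    exists2 r, {in U &, injective r} &
      {in U, forall x, #|later r (eset G) x :&: U| <= d}.
  exists r => // x.
  have [xG|xG] := boolP (x \in vset G).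
    apply: leq_trans (rP x xG); apply/subset_leq_card/subsetP => y yx.
    rewrite inE yx; rewrite inE in yx; case/andP: yx => /edge_vset/andP[_ ->] //.
  suff -> : later r (eset G) x = set0 by rewrite cards0.
  apply/setP => y; rewrite !inE; apply: contraNF xG.
  by case/andP => /edge_vset/andP[->].
move=> U; have [n] := ubnP #|U|; elim: n => // n IHn in U * => leUn UG.
have [->|U0] := eqVneq U set0; first by exists (fun=> 0) => x; rewrite inE.
have wfH : wf_graph (U, [set e in eset G | e \subset U]).
  apply/forall_inP => e; rewrite inE => /andP[eG ->].
  by have /andP[->] := forall_inP (gdataP G) e eG.
have [|x xU degx] := degG (SGraph wfH) _ U0.
  rewrite /subgraph UG; apply/subsetP => e; rewrite inE; by case/andP.
have [||r r_inj rP] := IHn (U :\ x).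
- by rewrite (cardsD1 x) xU in leUn.
- exact: subset_trans (subsetDl _ _) UG.
(* The removed vertex comes first, so it is later than no other vertex, and its own later neighbours
   in [U] are bounded by its degree. *)
exists (fun y => if y == x then 0 else (r y).+1) => [y z yU zU|y yU].
  case: eqP => [->|/eqP yx]; case: eqP => [->|/eqP zx] // [].
  by apply: r_inj; rewrite !inE ?yx ?zx.
have [->|yx] := eqVneq y x.
  apply: leq_trans degx; rewrite degE; apply/subset_leq_card/subsetP => z.
  by rewrite !inE /adj inE subUset !sub1set xU => /andP[/andP[-> _] ->].
apply: leq_trans (rP y _); last by rewrite !inE yx.
apply/subset_leq_card/subsetP => z; rewrite !inE (negbTE yx).
by case: eqP; rewrite ?andbF.
Qed.

(** * Consequences of the maximal density *)

Lemma density_bound G H : subgraph H G ->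
  (#|eset H|%:R <= max_density G * #|vset H|%:R)%R.
Proof.
move=> HG; have [V0|V0] := eqVneq (vset H) set0.
  suff -> : eset H = set0 by rewrite V0 !cards0 mulr0.
  apply/setP => e; rewrite inE; apply/negP => eH.
  have /andP[/cards2P[x [y [_ ->]]]] := forall_inP (gdataP H) e eH.
  by rewrite subUset !sub1set [gdata H](surjective_pairing) [_.1]V0 inE.
rewrite -ler_pdivrMr ?ltr0n ?card_gt0 //.
by apply: (le_bigmax_cond 0%R (@density T)); rewrite HG.
Qed.

Lemma max_density_ge0 G : (0 <= max_density G)%R.
Proof. exact: bigmax_ge_id. Qed.

(** The minimum degree of a subgraph is at most its average degree, hence at most
    [2 * max_density G]; being an integer, it is at most the floor. *)
Lemma degenerate_density G : degenerate (Num.truncn (2 * max_density G)%R) G.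
Proof.
move=> H HG /set0Pn[x0 x0H].
case: (arg_minnP (deg H) x0H) => x xH minx; exists x => //.
rewrite truncn_ge_nat ?mulr_ge0 ?max_density_ge0 //.
have handshake : \sum_(y in vset H) deg H y = 2 * #|eset H|.
  rewrite mulnC -sum_nat_const.
  under eq_bigr do rewrite /deg -sum1_card.
  rewrite (exchange_big_dep (mem (eset H))) /=; last first.
    by move=> y e _; rewrite inE; case/andP.
  apply: eq_bigr => e eH; rewrite sum1dep_card.
  have /andP[/eqP <- /subsetP eV] := forall_inP (gdataP H) e eH.
  by apply: eq_card => y; rewrite !inE eH andb_idl // => /eV.
have leH : #|vset H| * deg H x <= 2 * #|eset H|.
  by rewrite -handshake -sum_nat_const leq_sum.
have V0 : (0 < #|vset H|%:R :> rat)%R by rewrite ltr0n; apply/card_gt0P; exists x.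
rewrite -(ler_pM2l V0) -natrM (le_trans (y := (2 * #|eset H|)%:R%R)) ?ler_nat //.
by rewrite natrM mulrCA ler_pM2l // mulrC density_bound.
Qed.

(** * Peeling off one forest *)

(* The numeric hypothesis on [c] says [m / (i - m) <= c]. *)
Lemma peel r i c G E :
    {in vset G &, injective r} -> E \subset eset G ->
    (max_density G < i%:R)%R ->
    (i%:R <= c.+1%:R * (i%:R - max_density G))%R ->
    (forall x, #|later r E x| <= i) ->
  exists F, [/\ subgraph F G, forall x, deg F x <= c.+1,
    forall x, #|later r (eset F) x| <= 1 &
    forall x, #|later r (E :\: eset F) x| <= i.-1].
Proof.
move=> r_inj EG m_lt_i le_c le_i.
have m_ge0 := max_density_ge0 G.
have i_gt0 : 0 < i by rewrite -(ltr0n rat); apply: le_lt_trans m_ge0 m_lt_i.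
have laterP x y : y \in later r E x ->
    [/\ x \in vset G, y \in vset G, [set x; y] \in E & r x < r y].
  rewrite inE => /andP[xyE le_r]; have xyG := subsetP EG _ xyE.
  have /andP[xG yG] := edge_vset xyG; split=> //.
  rewrite ltn_neqAle le_r andbT; apply: contraNneq (edge_neq xyG).
  by move/r_inj => ->.
pose D := [set x | #|later r E x| == i].
have DG x : x \in D -> x \in vset G.
  rewrite inE => /eqP cardx; have /card_gt0P[y yx] : 0 < #|later r E x| by rewrite cardx.
  by have [] := laterP x y yx.
have [S SD|f [fN f_le]] := @hall_capacity T T id c D (later r E).
  set N := \bigcup_(x in S) _.
  (* These are the edges leaving [S], oriented upwards. No edge is counted twice, since [r] strictly
     increases along each pair. *)
  pose P := [set p : T * T | (p.1 \in S) && (p.2 \in later r E p.1)].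
  have cardP : #|P| = i * #|S|.
    rewrite -sum1dep_card -(pair_big_dep _ (fun x => mem (later r E x)) (fun _ _ => 1)).
    rewrite mulnC -sum_nat_const; apply: eq_bigr => x /(subsetP SD).
    by rewrite inE sum1_card => /eqP.
  have inP x y : (x, y) \in P -> x \in S /\ y \in later r E x.
    by rewrite inE => /andP[].
  have P_inj : {in P &, injective (fun p => [set p.1; p.2])}.
    move=> [x y] [x' y'] /inP[_ /laterP[_ _ _ xy]] /inP[_ /laterP[_ _ _ xy']] /setP /= eq.
    have := eq x; have := eq y; rewrite !inE !eqxx orbT /=.
    case/esym/orP=> /eqP ey; case/esym/orP=> /eqP ex; subst=> //.
    - by rewrite ltnn in xy.
    - by move: (ltn_trans xy xy'); rewrite ltnn.
    - by rewrite ltnn in xy.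
  have wfW : wf_graph (S :|: N, [set [set p.1; p.2] | p in P]).
    apply/forall_inP => _ /imsetP[[x y] /inP[xS yx] ->].
    have [_ _ /(subsetP EG) /edge_neq xy _] := laterP _ _ yx.
    rewrite cards2 xy subUset !sub1set !inE xS.
    by apply/orP; right; apply/bigcupP; exists x.
  have WG : subgraph (SGraph wfW) G.
    apply/andP; split; last first.
      apply/subsetP => _ /imsetP[[x y] /inP[xS yx] ->].
      by have [_ _ /(subsetP EG)] := laterP _ _ yx.
    rewrite subUset; apply/andP; split; apply/subsetP => x.
      by move/(subsetP SD)/DG.
    by case/bigcupP => y _ /laterP[].
  have := density_bound WG; rewrite card_in_imset // cardP natrM /= => dens.
  have leU : (#|S :|: N|%:R <= #|S|%:R + #|N|%:R :> rat)%R.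
    by rewrite -natrD ler_nat cardsU leq_subr.
  rewrite -(ler_nat rat) natrM.
  set s := (#|S|%:R)%R in dens leU *; set n := (#|N|%:R)%R in leU *.
  set m := max_density G in m_ge0 m_lt_i le_c dens *.
  have n_ge0 : (0 <= n)%R by [].
  (* The density bound reads [i * s <= m * (s + n)]. Since [m <= c * (i - m)], dividing by
     [i - m > 0] gives Hall's condition [s <= c * n]. *)
  have h1 : ((i%:R - m) * s <= m * n)%R.
    have := ler_wpM2l m_ge0 leU; rewrite /vset /= in dens *; lra.
  have h2 : (m * n <= c%:R * (i%:R - m) * n)%R.
    by apply: ler_wpM2r => //; rewrite -natr1 mulrDl in le_c; lra.
  have d_gt0 : (0 < i%:R - m)%R by rewrite subr_gt0.
  by rewrite -(ler_pM2l d_gt0) mulrCA mulrA (le_trans h1).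
have fD x : x \in D -> [/\ x \in vset G, f x \in vset G, [set x; f x] \in E & r x < r (f x)].
  by move=> xD; apply/laterP/fN.
have wfF : wf_graph (vset G, [set [set x; f x] | x in D]).
  apply/forall_inP => _ /imsetP[x /fD[_ _ /(subsetP EG) xfx _] ->].
  exact: (forall_inP (gdataP G) _ xfx).
have adjF x y : adj (SGraph wfF) x y ->
    x \in D /\ y = f x \/ y \in D /\ x = f y.
  move=> xyF; have := edge_neq xyF; case/imsetP: xyF => z zD eq.
  have : x \in [set z; f z] by rewrite -eq set21.
  have : y \in [set z; f z] by rewrite -eq set22.
  by case/set2P=> -> /set2P[]->; rewrite ?eqxx //; [right | left].
exists (SGraph wfF); split.
- apply/andP; split; rewrite ?subxx //.
  by apply/subsetP => _ /imsetP[x /fD[_ _ /(subsetP EG)] ? _ ->].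
- move=> x; rewrite degE.
  (* The neighbours of [x] in the new graph are at most its own choice [f x] and the at most [c]
     vertices choosing [x]; hence [c.+1]. *)
  apply: (@leq_trans #|f x |: [set y in D | f y == x]|).
    apply/subset_leq_card/subsetP => y; rewrite !inE => /adjF[[_ ->]|[yD ->]].
      by rewrite eqxx.
    by rewrite inE in yD; rewrite yD eqxx orbT.
  by rewrite cardsU1 -add1n leq_add ?leq_b1.
- move=> x; rewrite -(cards1 (f x)); apply/subset_leq_card/subsetP => y.
  (* A vertex that chose [x] precedes it, so only [f x] can be later. *)
  rewrite !inE => /andP[/adjF[[_ ->]//|[/fD[_ _ _ lt_r] def_x]]].
  by rewrite def_x leqNgt lt_r.
move=> x; have sub := later_sub r x (subsetDl E (eset (SGraph wfF))).
(* Outside [D] there were already at most [i.-1] later neighbours; inside [D] the neighbour [f x] is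
   lost. *)
have [xD|xD] := boolP (x \in D); last first.
  rewrite -ltnS prednK //; apply: leq_ltn_trans (subset_leq_card sub) _.
  by rewrite ltn_neqAle le_i andbT; rewrite inE in xD.
have /eqP <- : #|later r E x| == i by rewrite inE in xD.
rewrite (cardsD1 (f x) (later r E x)) fN //=; apply/subset_leq_card/subsetP => y yx.
rewrite !inE in yx *; case/andP: yx => /andP[yF ->] ->; rewrite !andbT.
by apply: contraNneq yF => ->; apply: imset_f.
Qed.

End Graph.

(** * Assembling the forests *)

Theorem proposition2p1 (T : finType) (G : sgraph T) :
  let m := max_density G in
  let k := Num.truncn m in
  let K := Num.truncn (2 * m)%R in
  exists F : nat -> sgraph T,
    (forall i : nat, k < i <= K ->
       [/\ subgraph (F i) G,
           is_forest (F i)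
         & ((max_deg (F i))%:Z <= Num.ceil (i%:R / (i%:R - m)))%R]) /\
    (forall j : nat, k <= j <= K ->
       let B := \big[@graph_union T/null_graph]_(j.+1 <= i < K.+1) F i in
       degenerate (K - j) B /\ degenerate j (delete_edges G B)).
Proof.
move=> m k K.
have m_ge0 : (0 <= m)%R := max_density_ge0 G.
have [r r_inj leK] := later_order (@degenerate_density T G).
have lt_m i : k < i -> (m < i%:R)%R by rewrite -truncn_lt_nat.
have peelG i c E := @peel T r i c G E r_inj; rewrite -/m in peelG leK.
rewrite -/K in leK; clearbody m k K.
pose B F j := \big[@graph_union T/null_graph]_(j.+1 <= i < K.+1) F i.
(* Induction on the number [n] of forests already peeled. All bounds are kept as counts of later
   neighbours for the single order [r], so that they add up over unions. *)
suff main n : n <= K - k ->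
    exists F : nat -> sgraph T,
    (forall i : nat, K - n < i <= K ->
       [/\ subgraph (F i) G,
           forall x, #|later r (eset (F i)) x| <= 1
         & ((max_deg (F i))%:Z <= Num.ceil (i%:R / (i%:R - m)))%R]) /\
    (forall j : nat, K - n <= j <= K ->
      (forall x, #|later r (eset (B F j)) x| <= K - j) /\
      (forall x, #|later r (eset G :\: eset (B F j)) x| <= j)).
  have [F [F1 F2]] := main _ (leqnn _).
  exists F; split=> [i ki|j kj].
    have [|FG F_le1 F_deg] := F1 i; first by lia.
    by split=> //; apply: later_forest F_le1.
  have [|B_le GB_le] := F2 j; first by lia.
  by split; apply: (@later_degenerate _ r); [apply: B_le | apply: GB_le].
elim: n => [_|n IHn ltn].
  exists (fun=> null_graph); split=> [i|j]; first by lia.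
  move=> Kj; have -> : j = K by lia.
  rewrite /B big_geq // setD0; split=> // x.
  by rewrite subnn leqn0 cards_eq0; apply/eqP/setP => y; rewrite !inE.
have [|F [F1 F2]] := IHn; first by lia.
set i := K - n in F1 F2; have iK : i <= K by apply: leq_subr.
have [|_ GB_le] := F2 i; first by rewrite leqnn.
have m_lt_i : (m < i%:R)%R by apply: lt_m; lia.
have d_gt0 : (0 < i%:R - m)%R by rewrite subr_gt0.
have ge1 : (1 <= i%:R / (i%:R - m))%R by rewrite ler_pdivlMr // mul1r gerBl.
(* The degree bound is split as [c.+1], one for a vertex's own choice and [c] for the capacity; the
   ceiling is positive because [i / (i - m) >= 1]. *)
have [c def_c] : exists c : nat, (Num.ceil (i%:R / (i%:R - m)) = c.+1%:Z)%R.
  have := le_trans ge1 (ceil_ge _); rewrite -[1%R]/(1%:~R)%R ler_int.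
  case: (Num.ceil _) => [[|c]|] // _; by exists c.
have le_c : (i%:R <= c.+1%:R * (i%:R - m))%R.
  by rewrite -ler_pdivrMr // (le_trans (ceil_ge _)) // def_c.
have [F0 [F0G F0_deg F0_le GF0_le]] := peelG _ _ _ (subsetDl _ _) m_lt_i le_c GB_le.
pose F' j := if j == i then F0 else F j.
(* [B F j] only involves indices above [j], so the new forest at [i] affects only [j = i.-1] in the
   range considered. *)
have BF' j : i <= j -> B F' j = B F j.
  move=> ij; apply: eq_big_nat => l /andP[jl _].
  by rewrite /F' gtn_eqF // (leq_ltn_trans ij).
have BF'i : B F' i.-1 = graph_union F0 (B F i).
  have i_gt0 : 0 < i by lia.
  rewrite -BF' // /B prednK // big_ltn ?ltnS //.
  by congr graph_union; rewrite /F' eqxx.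
exists F'; split=> [j j_bd|j j_bd].
  rewrite /F'; case: eqP => [->|/eqP ji]; last by apply: F1; lia.
  split=> //; rewrite def_c lez_nat; apply/bigmax_leqP => x _; exact: F0_deg.
have [ij|ji] := leqP i j; first by rewrite BF' //; apply: F2; lia.
have -> : j = i.-1 by lia.
have [|B_le _] := F2 i; first by rewrite leqnn.
have -> : eset (B F' i.-1) = eset F0 :|: eset (B F i) by rewrite BF'i.
split=> x; first last.
  by rewrite setUC -setDDl; exact: GF0_le.
apply: (@leq_trans (#|later r (eset F0) x| + #|later r (eset (B F i)) x|)).
  apply: leq_trans (leq_card_setU _ _); apply/subset_leq_card/subsetP => y.
  by rewrite !inE -andb_orl.
by have := F0_le x; have := B_le x; lia.
Qed.
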